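(* Let $\{A,B,C\}$ be a set of three distinct points, all in $H^2$ or all in $-H^2$ (a hyperbolic or antipodal hyperbolic triangle), with side lengths $a,b,c$ opposite $A,B,C$ and angles $\alpha,\beta,\gamma$ at $A,B,C$, respectively. Then $$\cos(\alpha)=-\cos(\beta)\cos(\gamma)+\cosh(a)\sin(\beta)\sin(\gamma),$$ $$\cos(\beta)=-\cos(\alpha)\cos(\gamma)+\cosh(b)\sin(\alpha)\sin(\gamma),$$ $$\cos(\gamma)=-\cos(\alpha)\cos(\beta)+\cosh(c)\sin(\alpha)\sin(\beta).$$
   Context: On $\mathbb{R}^3$ let $\langle\langle x,y\rangle\rangle=-x_1y_1+x_2y_2+x_3y_3$, $|||x|||=\sqrt{|\langle\langle x,x\rangle\rangle|}$, and let $\times$ be the usual Euclidean cross product. $H^2=\{x:\langle\langle x,x\rangle\rangle=-1,\ x_1>0\}$ and $-H^2=\{-x:x\in H^2\}$. For $x,y$ both in $H^2$ or both in $-H^2$ the distance is $d(x,y)=\operatorname{arcosh}(-\langle\langle x,y\rangle\rangle)$. Side lengths: $a=d(B,C)$, $b=d(A,C)$, $c=d(A,B)$. For distinct $A,B$ both in $H^2$ or both in $-H^2$, the unit tangent vector at $A$ towards $B$ is $X_{AB}=\dfrac{B+\langle\langle A,B\rangle\rangle A}{|||A\times B|||}$. The angle at $A$ is $\alpha=\arccos(\langle\langle X_{AB},X_{AC}\rangle\rangle)$; $\beta$ (at $B$) and $\gamma$ (at $C$) are defined analogously. *)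

(* Defs.v *)
From mathcomp Require Import all_boot all_order all_algebra.
From mathcomp Require Import all_classical all_reals all_analysis.

Set Implicit Arguments.
Unset Strict Implicit.
Unset Printing Implicit Defensive.

Import Order.TTheory GRing.Theory Num.Theory.

Local Open Scope classical_set_scope.
Local Open Scope ring_scope.

Definition cosh (R : realType) (x : R) : R := (expR x + expR (- x)) / 2.

(* The inverse of [cosh] on [0, +oo[, in closed form; the formula is only
   meaningful for 1 <= x. *)
Definition arcosh (R : realType) (x : R) : R := ln (x + Num.sqrt (x ^+ 2 - 1)).

(* The coordinates x_1, x_2, x_3 of a vector are x 0 0, x 0 1, x 0 2. *)
Definition lorentz (R : realType) (x y : 'rV[R]_3) : R :=
  - (x 0 0 * y 0 0) + x 0 1 * y 0 1 + x 0 2 * y 0 2.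

Definition lorentz_norm (R : realType) (x : 'rV[R]_3) : R :=
  Num.sqrt `|lorentz x x|.

Definition crossprod (R : realType) (x y : 'rV[R]_3) : 'rV[R]_3 :=
  \row_(i < 3) [:: x 0 1 * y 0 2 - x 0 2 * y 0 1;
                   x 0 2 * y 0 0 - x 0 0 * y 0 2;
                   x 0 0 * y 0 1 - x 0 1 * y 0 0]`_i.

Definition hyperbolic_plane (R : realType) : set 'rV[R]_3 :=
  [set x | lorentz x x = -1 /\ 0 < x 0 0].

Definition antipodal_hyperbolic_plane (R : realType) : set 'rV[R]_3 :=
  [set - x | x in @hyperbolic_plane R].

Definition hyperbolic_triangle (R : realType) (A B C : 'rV[R]_3) : Prop :=
  [/\ A <> B, A <> C & B <> C] /\
  ([set A; B; C] `<=` @hyperbolic_plane R \/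
   [set A; B; C] `<=` @antipodal_hyperbolic_plane R).

Definition hyperbolic_dist (R : realType) (x y : 'rV[R]_3) : R :=
  arcosh (- lorentz x y).

Definition unit_tangent (R : realType) (A B : 'rV[R]_3) : 'rV[R]_3 :=
  (lorentz_norm (crossprod A B))^-1 *: (B + lorentz A B *: A).

(* The angle at the vertex A between the sides towards B and C. *)
Definition hyperbolic_angle (R : realType) (A B C : 'rV[R]_3) : R :=
  acos (lorentz (unit_tangent A B) (unit_tangent A C)).

(* Main.v *)
Require Import Defs.
From mathcomp Require Import all_boot all_order all_algebra.
From mathcomp Require Import all_classical all_reals all_analysis.
From mathcomp Require Import ring lra.

(** With [p = cosh a], [q = cosh b], [r = cosh c], the Gram matrix of [A, B, C]
for the Lorentz form has diagonal [-1] and off-diagonal entries [-p, -q, -r],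
and its determinant is minus the square of the Euclidean determinant of
[A, B, C].  Hence [G = 1 - p^2 - q^2 - r^2 + 2 p q r >= 0], which makes the
quotient [(q r - p) / (sqrt (q^2 - 1) sqrt (r^2 - 1))] a genuine cosine, namely
[cos alpha], with sine [sqrt G / (sqrt (q^2 - 1) sqrt (r^2 - 1))].  The law then
reduces to [(p r - q) (p q - r) + (q r - p) (p^2 - 1) = p G]. *)

Import Order.TTheory GRing.Theory Num.Theory.

Local Open Scope ring_scope.

(** With [s = sqrt (x^2 - 1)], the numbers [x + s] and [x - s] are reciprocal, hence are the two
    exponentials, and their mean is [x]. *)
Lemma cosh_arcosh (R : realType) (x : R) : 1 <= x -> cosh (arcosh x) = x.
Proof.
move=> x1; have h : 0 <= x ^+ 2 - 1 by nra.
have s0 := sqrtr_ge0 (x ^+ 2 - 1); have s2 := sqr_sqrtr h.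
rewrite /cosh /arcosh; set s := Num.sqrt _ in s0 s2 *.
have xs : 0 < x + s by lra.
rewrite expRN lnK ?posrE //.
have -> : (x + s)^-1 = x - s.
  by apply: (mulfI (lt0r_neq0 xs)); rewrite divff ?lt0r_neq0 //; lra.
by field.
Qed.

Lemma lorentzC {R : realType} (x y : 'rV[R]_3) : lorentz x y = lorentz y x.
Proof. by rewrite /lorentz; ring. Qed.

Lemma hyperbolic_angleC {R : realType} (A B C : 'rV[R]_3) :
  hyperbolic_angle A B C = hyperbolic_angle A C B.
Proof. by rewrite /hyperbolic_angle lorentzC. Qed.

(** Lagrange's identity for the Lorentz form; the sign is opposite to the Euclidean one because
    [diag(-1, 1, 1)] has determinant [-1]. *)
Lemma lorentz_crossprod (R : realType) (x y : 'rV[R]_3) :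
  lorentz (crossprod x y) (crossprod x y) =
  lorentz x y ^+ 2 - lorentz x x * lorentz y y.
Proof. by rewrite /lorentz !mxE /=; ring. Qed.

Lemma lorentz_gram_le0 {R : realType} (x y z : 'rV[R]_3) :
  lorentz x x * lorentz y y * lorentz z z
  + 2 * lorentz x y * lorentz y z * lorentz x z
  - lorentz x x * lorentz y z ^+ 2 - lorentz y y * lorentz x z ^+ 2
  - lorentz z z * lorentz x y ^+ 2 <= 0.
Proof.
pose c := crossprod y z.
(* The squared quantity is the triple product of [x], [y], [z], that is, their Euclidean
   determinant. *)
rewrite [leLHS](_ : _ =
  - (x 0 0 * c 0 0 + x 0 1 * c 0 1 + x 0 2 * c 0 2) ^+ 2).
  by rewrite oppr_le0 sqr_ge0.
by rewrite /lorentz !mxE /=; ring.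
Qed.

Lemma lorentz_tangent (R : realType) (A B C : 'rV[R]_3) :
  lorentz A A = -1 ->
  lorentz (unit_tangent A B) (unit_tangent A C) =
  (lorentz A B * lorentz A C + lorentz B C) /
  (lorentz_norm (crossprod A B) * lorentz_norm (crossprod A C)).
Proof.
move=> hA; rewrite /unit_tangent invfM.
set u := (lorentz_norm (crossprod A B))^-1.
set v := (lorentz_norm (crossprod A C))^-1.
(* Bilinear expansion: the two cross terms give the [2], the product of the two multiples of [A]
   gives [lorentz A A], so the coefficient becomes [1]. *)
transitivity ((lorentz B C + (2 + lorentz A A) * lorentz A B * lorentz A C)
  * (u * v)); last by rewrite hA; ring.
by rewrite /lorentz !mxE; ring.
Qed.

(* The product condition on first coordinates says that the two points lie on
the same sheet, treating [H^2] and [-H^2] at once. *)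
Definition same_sheet {R : realType} (x y : 'rV[R]_3) : Prop :=
  [/\ lorentz x x = -1, lorentz y y = -1 & 0 < x 0 0 * y 0 0].

Lemma same_sheetC {R : realType} {x y : 'rV[R]_3} :
  same_sheet x y -> same_sheet y x.
Proof. by case=> hx hy hxy; split=> //; rewrite mulrC. Qed.

(** Strict reversed Cauchy-Schwarz inequality; its strictness keeps the denominators of the angle
    formulas nonzero. *)
Lemma lorentz_lt_N1 {R : realType} {x y : 'rV[R]_3} :
  same_sheet x y -> x <> y -> 1 < - lorentz x y.
Proof.
case=> hx hy h0 xy.
(* The last two coordinates determine the first up to sign, and the common sheet fixes the sign. *)
have d0 : 0 < (x 0 1 - y 0 1) ^+ 2 + (x 0 2 - y 0 2) ^+ 2.
  rewrite lt_neqAle addr_ge0 ?sqr_ge0 // andbT eq_sym.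
  apply/negP; rewrite paddr_eq0 ?sqr_ge0 // !sqrf_eq0 !subr_eq0.
  case/andP => /eqP e1 /eqP e2; apply: xy.
  have /eqP e0 : x 0 0 ^+ 2 == y 0 0 ^+ 2.
    by apply/eqP; move: hx hy; rewrite /lorentz e1 e2; lra.
  have {}e0 : x 0 0 = y 0 0.
    have /orP[/eqP //|/eqP e] : (x 0 0 == y 0 0) || (x 0 0 == - y 0 0).
      by rewrite -eqf_sqr e0.
    by move: h0; rewrite e; nra.
  apply/rowP => -[[|[|[|//]]] i].
  - by rewrite (_ : Ordinal i = 0) //; apply: val_inj.
  - by rewrite (_ : Ordinal i = 1) //; apply: val_inj.
  - by rewrite (_ : Ordinal i = 2) //; apply: val_inj.
move: hx hy h0 d0; rewrite /lorentz.
set x0 := x 0 0; set x1 := x 0 1; set x2 := x 0 2.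
set y0 := y 0 0; set y1 := y 0 1; set y2 := y 0 2.
move=> hx hy h0 d0.
suff : `|1 + x1 * y1 + x2 * y2| < x0 * y0.
  by move=> /(le_lt_trans (ler_norm _)); lra.
rewrite -(gtr0_norm h0) -ltr_sqr ?nnegrE ?normr_ge0 // !real_normK ?num_real //.
have -> : (x0 * y0) ^+ 2 = (1 + x1 ^+ 2 + x2 ^+ 2) * (1 + y1 ^+ 2 + y2 ^+ 2).
  rewrite exprMn (_ : x0 ^+ 2 = 1 + x1 ^+ 2 + x2 ^+ 2); last by lra.
  by rewrite (_ : y0 ^+ 2 = 1 + y1 ^+ 2 + y2 ^+ 2) //; lra.
(* Lagrange's identity for the Euclidean vectors [(1, x1, x2)] and [(1, y1, y2)]. *)
rewrite -subr_gt0 [ltRHS](_ : _ = (x1 - y1) ^+ 2 + (x2 - y2) ^+ 2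
  + (x1 * y2 - x2 * y1) ^+ 2); last by ring.
by rewrite ltr_wpDr ?sqr_ge0.
Qed.

Lemma cosh_hyperbolic_dist (R : realType) (x y : 'rV[R]_3) :
  same_sheet x y -> x <> y -> cosh (hyperbolic_dist x y) = - lorentz x y.
Proof. by move=> hs xy; rewrite cosh_arcosh // ltW // lorentz_lt_N1. Qed.

Lemma lorentz_norm_crossprod {R : realType} {x y : 'rV[R]_3} :
  same_sheet x y -> x <> y ->
  lorentz_norm (crossprod x y) = Num.sqrt (lorentz x y ^+ 2 - 1).
Proof.
move=> hs xy; have h := lorentz_lt_N1 hs xy; case: hs => hx hy _.
rewrite /lorentz_norm lorentz_crossprod hx hy ger0_norm ?mulrNN ?mulr1 //.
by nra.
Qed.

Lemma cos_sin_hyperbolic_angle {R : realType} (A B C : 'rV[R]_3)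
    (p := - lorentz B C) (q := - lorentz A C) (r := - lorentz A B)
    (s := Num.sqrt (r ^+ 2 - 1) * Num.sqrt (q ^+ 2 - 1)) :
  same_sheet A B -> same_sheet A C -> A <> B -> A <> C ->
  cos (hyperbolic_angle A B C) = (q * r - p) / s /\
  sin (hyperbolic_angle A B C) =
    Num.sqrt (1 - p ^+ 2 - q ^+ 2 - r ^+ 2 + 2 * p * q * r) / s.
Proof.
move=> sAB sAC AB AC.
have r1 : 1 < r := lorentz_lt_N1 sAB AB.
have q1 : 1 < q := lorentz_lt_N1 sAC AC.
have hang : lorentz (unit_tangent A B) (unit_tangent A C) = (q * r - p) / s.
  case: (sAB) => hA _ _; rewrite lorentz_tangent // !lorentz_norm_crossprod //.
  by rewrite /s /p /q /r !sqrrN; congr (_ / _); ring.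
have := lorentz_gram_le0 A B C.
case: sAB sAC => [-> -> _] [_ -> _] gram.
set G := 1 - _ - _ - _ + _; have G0 : 0 <= G by rewrite /G /p /q /r; lra.
have r2 : 0 < r ^+ 2 - 1 by nra.
have q2 : 0 < q ^+ 2 - 1 by nra.
have s0 : 0 < s by rewrite mulr_gt0 ?sqrtr_gt0.
have s2 : s ^+ 2 = (r ^+ 2 - 1) * (q ^+ 2 - 1).
  by rewrite exprMn !sqr_sqrtr // ltW.
(* This serves twice: it puts the quotient in [[-1, 1]], where [cos] inverts [acos], and it gives
   the sine. *)
have sin2 : 1 - ((q * r - p) / s) ^+ 2 = G / s ^+ 2.
  rewrite expr_div_n -[X in X - _](@divff _ (s ^+ 2)) ?expf_neq0 ?gt_eqF //.
  by rewrite -mulrBl s2 /G; congr (_ / _); ring.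
have : ((q * r - p) / s) ^+ 2 <= 1.
  by rewrite -subr_ge0 sin2 divr_ge0 // sqr_ge0.
rewrite -real_normK ?num_real // expr_le1 ?normr_ge0 // ler_norml => h.
rewrite /hyperbolic_angle hang acosK ?in_itv //; split => //.
by rewrite sin_acos // sin2 sqrtrM // sqrtrV ?sqr_ge0 // sqrtr_sqr gtr0_norm.
Qed.

Lemma hyperbolic_dual_law_of_cosines (R : realType) (A B C : 'rV[R]_3) :
  same_sheet A B -> same_sheet A C -> same_sheet B C ->
  A <> B -> A <> C -> B <> C ->
  cos (hyperbolic_angle A B C) =
  - (cos (hyperbolic_angle B A C) * cos (hyperbolic_angle C A B))
  + cosh (hyperbolic_dist B C) * sin (hyperbolic_angle B A C)
    * sin (hyperbolic_angle C A B).
Proof.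
move=> sAB sAC sBC AB AC BC.
have [sBA sCA sCB] : [/\ same_sheet B A, same_sheet C A & same_sheet C B].
  by split; apply: same_sheetC.
have [-> _] := cos_sin_hyperbolic_angle A B C sAB sAC AB AC.
have [-> ->] := cos_sin_hyperbolic_angle B A C sBA sBC (nesym AB) BC.
have [-> ->] := cos_sin_hyperbolic_angle C A B sCA sCB (nesym AC) (nesym BC).
rewrite cosh_hyperbolic_dist // (lorentzC B A) (lorentzC C A).
rewrite (lorentzC C B).
have := lorentz_gram_le0 A B C.
case: (sAB) (sAC) => [-> -> _] [_ -> _].
have := lorentz_lt_N1 sAB AB; have := lorentz_lt_N1 sAC AC.
have := lorentz_lt_N1 sBC BC.
(* Double negations make every Lorentz product appear negated, so that generalizing leaves only [p],
   [q], [r]. *)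
rewrite -[in X in _ -> _ -> _ -> X](opprK (lorentz A B)).
rewrite -[in X in _ -> _ -> _ -> X](opprK (lorentz A C)).
rewrite -[in X in _ -> _ -> _ -> X](opprK (lorentz B C)).
move: (- lorentz B C) (- lorentz A C) (- lorentz A B) => p q r p1 q1 r1 gram.
rewrite !opprK.
set G := 1 - p ^+ 2 - q ^+ 2 - r ^+ 2 + 2 * p * q * r.
have -> : 1 - q ^+ 2 - p ^+ 2 - r ^+ 2 + 2 * q * p * r = G by rewrite /G; ring.
have -> : 1 - r ^+ 2 - p ^+ 2 - q ^+ 2 + 2 * r * p * q = G by rewrite /G; ring.
have G0 : 0 <= G by rewrite /G; lra.
have p2 : 0 < p ^+ 2 - 1 by nra.
have q2 : 0 < q ^+ 2 - 1 by nra.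
have r2 : 0 < r ^+ 2 - 1 by nra.
have hG := sqr_sqrtr G0; have hp := sqr_sqrtr (ltW p2).
move: p2 q2 r2; rewrite -(sqrtr_gt0 (p ^+ 2 - 1)) -(sqrtr_gt0 (q ^+ 2 - 1)).
rewrite -(sqrtr_gt0 (r ^+ 2 - 1)).
move: (Num.sqrt G) (Num.sqrt (p ^+ 2 - 1)) hG hp => g sp hG hp.
move: (Num.sqrt (q ^+ 2 - 1)) (Num.sqrt (r ^+ 2 - 1)) => sq sr.
move=> /lt0r_neq0 p0 /lt0r_neq0 q0 /lt0r_neq0 r0.
(* Both sides are brought over [sp ^+ 2 * sq * sr], the common denominator at [B] and [C]; the
   numerators then agree by the polynomial identity. *)
transitivity ((- ((p * r - q) * (p * q - r)) + p * g ^+ 2)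
  / (sp ^+ 2 * sq * sr)); last by field; rewrite p0 q0 r0.
transitivity ((q * r - p) * sp ^+ 2 / (sp ^+ 2 * sq * sr)).
  by field; rewrite p0 q0 r0.
by rewrite hp hG /G; congr (_ / _); ring.
Qed.

Lemma hyperbolic_triangle_same_sheet {R : realType} {A B C : 'rV[R]_3} :
  hyperbolic_triangle A B C ->
  [/\ same_sheet A B, same_sheet A C & same_sheet B C].
Proof.
case=> _ [] sub.
- have [hA A0] := sub A (or_introl (or_introl erefl)).
  have [hB B0] := sub B (or_introl (or_intror erefl)).
  have [hC C0] := sub C (or_intror erefl).
  by split; split=> //; rewrite mulr_gt0.
- have lorentzNN (x : 'rV[R]_3) : lorentz (- x) (- x) = lorentz x x.
    by rewrite /lorentz !mxE; ring.
  have [A' [hA A0] <-] := sub A (or_introl (or_introl erefl)).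
  have [B' [hB B0] <-] := sub B (or_introl (or_intror erefl)).
  have [C' [hC C0] <-] := sub C (or_intror erefl).
  by split; split; rewrite ?lorentzNN // !mxE mulrNN mulr_gt0.
Qed.

Theorem theorem5p6 (R : realType) (A B C : 'rV[R]_3)
    (hABC : hyperbolic_triangle A B C) :
  let a := hyperbolic_dist B C in
  let b := hyperbolic_dist A C in
  let c := hyperbolic_dist A B in
  let alpha := hyperbolic_angle A B C in
  let beta := hyperbolic_angle B A C in
  let gamma := hyperbolic_angle C A B in
  [/\ cos alpha = - (cos beta * cos gamma) + cosh a * sin beta * sin gamma,
      cos beta = - (cos alpha * cos gamma) + cosh b * sin alpha * sin gamma &
      cos gamma = - (cos alpha * cos beta) + cosh c * sin alpha * sin beta].
Proof.
have [sAB sAC sBC] := hyperbolic_triangle_same_sheet hABC.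
have [[AB AC BC] _] := hABC.
have [sBA sCA sCB] : [/\ same_sheet B A, same_sheet C A & same_sheet C B].
  by split; apply: same_sheetC.
move=> a b c alpha beta gamma; split.
- exact: hyperbolic_dual_law_of_cosines.
(* The other two laws are the same lemma read from [B] and from [C], after swapping the sides of
   some angles. *)
- rewrite /gamma hyperbolic_angleC.
  by apply: hyperbolic_dual_law_of_cosines => // /esym.
- rewrite /alpha /beta (hyperbolic_angleC A) (hyperbolic_angleC B).
  by apply: hyperbolic_dual_law_of_cosines => // /esym.
Qed.
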